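(* Let $\varphi$ be a strictly increasing symbol for $\mathcal{S}(\mathbb{R})$, and let $C_\varphi:\mathcal{S}(\mathbb{R})\to\mathcal{S}(\mathbb{R})$, $f\mapsto f\circ\varphi$. Then: (a) $\sigma_p(C_\varphi)\subset\{1\}$. (b) $\sigma_p(C_\varphi)=\{1\}$ if and only if the set $\{t\in\mathbb{R}:\varphi(t)=t\}$ has interior points.
   Context: $\mathcal{S}(\mathbb{R})$ is the Schwartz space of smooth rapidly decreasing functions $f:\mathbb{R}\to\mathbb{C}$ with its usual Fréchet topology, given by the seminorms $\pi_n(f)=\sup_{x\in\mathbb{R}}\sup_{0\le j\le n}(1+|x|^2)^n|f^{(j)}(x)|$, $n\in\mathbb{N}$. A smooth function $\varphi:\mathbb{R}\to\mathbb{R}$ is a symbol for $\mathcal{S}(\mathbb{R})$ if $f\mapsto f\circ\varphi$ maps $\mathcal{S}(\mathbb{R})$ continuously into itself. $\sigma_p(C_\varphi)$ is the set of all eigenvalues $\lambda\in\mathbb{C}$ of $C_\varphi$. *)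

(* Defs.v *)
From HB Require Import structures.
From mathcomp Require Import all_boot all_order all_algebra.
From mathcomp Require Import all_classical all_reals all_analysis.
From mathcomp Require Import complex.

Set Implicit Arguments.
Unset Strict Implicit.
Unset Printing Implicit Defensive.

Import Order.TTheory GRing.Theory Num.Theory.
Import numFieldNormedType.Exports.

Local Open Scope ring_scope.
Local Open Scope classical_set_scope.

(* [Rcomplex R] is the carrier of [R[i]] seen as a real vector space, normed   *)
(* by the real-valued modulus. Making it a [normedModType R] gives meaning to  *)
(* the derivatives of a function from [R] to the complex numbers.              *)
Section Rcomplex_normedModule.
Context {R : realType}.

HB.instance Definition _ :=
  PseudoMetric.copy (Rcomplex R) (pseudoMetric_normed (Rcomplex R)).
HB.instance Definition _ := isPointed.Build (Rcomplex R) 0.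
HB.instance Definition _ :=
  NormedZmod_PseudoMetric_eq.Build R (Rcomplex R) erefl.

Lemma Rcomplex_normM (x y : Rcomplex R) : `|x * y : Rcomplex R| = `|x| * `|y|.
Proof. exact: Normc.normcM. Qed.

Fact Rcomplex_normZ (l : R) (x : Rcomplex R) : `|l *: x| = `|l| * `|x|.
Proof.
have -> : l *: x = (l%:C%C : Rcomplex R) * x.
  by case: x => a b; rewrite /GRing.mul /= !mul0r subr0 addr0.
rewrite Rcomplex_normM; congr (_ * _).
by rewrite /Num.norm /= expr0n /= addr0 sqrtr_sqr.
Qed.

HB.instance Definition _ :=
  PseudoMetricNormedZmod_Lmodule_isNormedModule.Build R (Rcomplex R)
    Rcomplex_normZ.

End Rcomplex_normedModule.

Definition smooth (R : realType) (V : normedModType R) (f : R -> V) : Prop :=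
  forall n x, derivable f^`(n) x 1.

Section schwartz_functions.
Context {R : realType}.
Local Notation C := (Rcomplex R).

Definition schwartz_norm (n : nat) (f : R -> C) : \bar R :=
  ereal_sup [set ((1 + `|x| ^+ 2) ^+ n * `|f^`(j)%classic x|)%:E
            | x in [set: R] & j in [set j | (j <= n)%N]].

Definition is_schwartz (f : R -> C) : Prop :=
  smooth f /\ forall n, (schwartz_norm n f < +oo)%E.

Lemma schwartz_normP n (f : R -> C) (M : R) :
  (schwartz_norm n f <= M%:E)%E <->
  forall x j, (j <= n)%N -> (1 + `|x| ^+ 2) ^+ n * `|f^`(j)%classic x| <= M.
Proof.
split=> [fM x j jn|fM].
  rewrite -lee_fin; apply: le_trans fM; apply: ereal_sup_ubound.
  by exists x => //; exists j.
by apply: ge_ereal_sup => _ [x _ [j jn <-]]; rewrite lee_fin; exact: fM.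
Qed.

Lemma schwartz_norm_ge0 n (f : R -> C) : (0 <= schwartz_norm n f)%E.
Proof.
apply: (@le_trans _ _ ((1 + `|0 : R| ^+ 2) ^+ n * `|f^`(0)%classic (0 : R)|)%:E).
  by rewrite lee_fin mulr_ge0 // exprn_ge0 // addr_ge0 // exprn_ge0.
by apply: ereal_sup_ubound; exists 0 => //; exists 0%N.
Qed.

Lemma schwartz_norm_fin n (f : R -> C) :
  (schwartz_norm n f < +oo)%E -> exists M, schwartz_norm n f = M%:E.
Proof.
by have := schwartz_norm_ge0 n f; case: schwartz_norm => // M _ _; exists M.
Qed.

Lemma derive1nD (f g : R -> C) n : smooth f -> smooth g ->
  (f \+ g)^`(n) = f^`(n) \+ g^`(n).
Proof.
move=> sf sg; elim: n => // n IHn; rewrite !derive1nS IHn.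
by apply/funext => x /=; rewrite !derive1E; apply: (deriveD (sf n x) (sg n x)).
Qed.

Lemma smoothD (f g : R -> C) : smooth f -> smooth g -> smooth (f \+ g).
Proof.
by move=> sf sg n x; rewrite derive1nD //; exact: (derivableD (sf n x) (sg n x)).
Qed.

Lemma Rcomplex_is_derive_mull (l : C) (f : R -> C) (x : R) : derivable f x 1 ->
  is_derive x 1 (fun y => l * f y) (l * 'D_1 f x).
Proof.
move=> df.
suff dl : h^-1 *: (((fun y => l * f y) \o shift x) (h *: 1) - l * f x)
    @[h --> 0^'] --> l * 'D_1 f x.
  apply: DeriveDef; first by apply/cvg_ex; eexists; exact: dl.
  exact: cvg_lim dl.
have : h^-1 *: ((f \o shift x) (h *: 1) - f x) @[h --> 0^'] --> 'D_1 f x.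
  exact: df.
move/cvgrPdist_lt => cf; apply/cvgrPdist_lt => /= e e0.
have l0 : 0 < `|l| + 1 by rewrite ltr_wpDl.
have := cf (e / (`|l| + 1)); rewrite divr_gt0 // => /(_ isT).
apply: filterS => h.
rewrite -mulrBr (mulrC l (_ - _)) scalerAl (mulrC _ l) -mulrBr.
rewrite Rcomplex_normM ltr_pdivlMr // mulrC.
by apply: le_lt_trans; rewrite ler_wpM2r // lerDl.
Qed.

Lemma derive1n_mull (l : C) (f : R -> C) n : smooth f ->
  (fun x => l * f x)^`(n) = (fun x => l * f^`(n)%classic x).
Proof.
move=> sf; elim: n => // n IHn; rewrite !derive1nS IHn.
apply/funext => x; rewrite !derive1E.
by have [_ ->] := Rcomplex_is_derive_mull l (sf n x).
Qed.

Lemma smooth_mull (l : C) (f : R -> C) : smooth f -> smooth (fun x => l * f x).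
Proof.
move=> sf n x; rewrite derive1n_mull //.
by have [] := Rcomplex_is_derive_mull l (sf n x).
Qed.

Lemma schwartz_normD n (f g : R -> C) : smooth f -> smooth g ->
  (schwartz_norm n (f \+ g)%R <= schwartz_norm n f + schwartz_norm n g)%E.
Proof.
move=> sf sg; apply: ge_ereal_sup => _ [x _ [j jn <-]].
rewrite derive1nD //.
have w0 : 0 <= (1 + `|x| ^+ 2) ^+ n.
  by rewrite exprn_ge0 // addr_ge0 // exprn_ge0.
apply: (@le_trans _ _ (((1 + `|x| ^+ 2) ^+ n * `|f^`(j)%classic x|)%:E +
                       ((1 + `|x| ^+ 2) ^+ n * `|g^`(j)%classic x|)%:E)%E).
  by rewrite -EFinD lee_fin -mulrDr ler_wpM2l // ler_normD.
by apply: leeD; apply: ereal_sup_ubound; exists x => //; exists j.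
Qed.

Fact is_schwartz0 : is_schwartz (fun=> 0).
Proof.
have d0 n : (fun=> 0 : C)^`(n) = (fun=> 0 : C) :> (R -> C).
  elim: n => // n IHn; rewrite derive1nS IHn; apply/funext => x.
  exact: derive1_cst.
split=> n; first by move=> x; rewrite d0; exact: derivable_cst.
apply: (@le_lt_trans _ _ 0%:E); last exact: ltry.
by apply/schwartz_normP => x j _; rewrite d0 normr0 mulr0.
Qed.

Fact is_schwartzD (f g : R -> C) :
  is_schwartz f -> is_schwartz g -> is_schwartz (f \+ g).
Proof.
move=> [sf nf] [sg ng]; split; first exact: smoothD.
move=> n; apply: le_lt_trans (schwartz_normD n sf sg) _.
by rewrite lte_add_pinfty.
Qed.

Fact is_schwartzZ (l : C) (f : R -> C) :
  is_schwartz f -> is_schwartz (fun x => l * f x).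
Proof.
move=> [sf nf]; split; first exact: smooth_mull.
move=> n; have [M fM] := schwartz_norm_fin (nf n).
apply: (@le_lt_trans _ _ (`|l| * M)%:E); last exact: ltry.
apply/schwartz_normP => x j jn; rewrite derive1n_mull // Rcomplex_normM.
rewrite mulrCA ler_wpM2l //.
have [+ _] := schwartz_normP n f M; apply => //; by rewrite fM.
Qed.

End schwartz_functions.

(* The codomain is [R[i]], not [Rcomplex R], for the scalars to be complex.    *)
Definition schwartz_pred (R : realType) : {pred R -> R[i]} :=
  mem [set f | is_schwartz f].

Record schwartz (R : realType) := Schwartz {
  schwartz_fun :> R -> R[i];
  schwartzP : schwartz_fun \in @schwartz_pred R }.

Section schwartz_space.
Context {R : realType}.

HB.instance Definition _ := [isSub for @schwartz_fun R].
HB.instance Definition _ := [Choice of schwartz R by <:].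

Fact schwartz_submod_closed : submod_closed (@schwartz_pred R).
Proof.
split; first by rewrite inE; exact: is_schwartz0.
move=> l f g; rewrite !inE => sf sg.
exact: (is_schwartzD (is_schwartzZ l sf) sg).
Qed.

HB.instance Definition _ :=
  GRing.isSubmodClosed.Build R[i] (R -> R[i]) (@schwartz_pred R)
    schwartz_submod_closed.
HB.instance Definition _ := [SubChoice_isSubLmodule of schwartz R by <:].

Lemma schwartz_is_schwartz (f : schwartz R) : is_schwartz f.
Proof. by have := schwartzP f; rewrite inE. Qed.

(* A single seminorm per basic neighbourhood is enough: they increase with n. *)
Definition schwartz_nbhs (f : schwartz R) : set_system (schwartz R) :=
  [set A | exists n, exists2 e : R, 0 < e &
    [set g : schwartz R | (schwartz_norm n (g - f : schwartz R)%R < e%:E)%E] `<=` A].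

HB.instance Definition _ := hasNbhs.Build (schwartz R) schwartz_nbhs.

Lemma schwartz_norm_homo (m n : nat) (f : schwartz R) : (m <= n)%N ->
  (schwartz_norm m f <= schwartz_norm n f)%E.
Proof.
move=> mn; apply: ge_ereal_sup => _ [x _ [j jm <-]].
apply: (@le_trans _ _ ((1 + `|x| ^+ 2) ^+ n * `|derive1n j (f : R -> Rcomplex R) x|)%:E).
  by rewrite lee_fin ler_wpM2r // ler_weXn2l // lerDl exprn_ge0.
by apply: ereal_sup_ubound; exists x => //; exists j => //; exact: leq_trans mn.
Qed.

Lemma schwartz_norm0 n : schwartz_norm n (0 : schwartz R) = 0%E.
Proof.
apply/eqP; rewrite eq_le schwartz_norm_ge0 andbT.
apply/schwartz_normP => x j _.
have -> : derive1n j ((0 : schwartz R) : R -> Rcomplex R) = fun=> 0.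
  elim: j => // j IHj; rewrite derive1nS IHj; apply/funext => y.
  exact: derive1_cst.
by rewrite normr0 mulr0.
Qed.

Lemma schwartz_norm_triangle n (f g : schwartz R) :
  (schwartz_norm n (f + g : schwartz R)%R <= schwartz_norm n f + schwartz_norm n g)%E.
Proof.
by apply: schwartz_normD; [case: (schwartz_is_schwartz f)|
                           case: (schwartz_is_schwartz g)].
Qed.

Fact schwartz_nbhs_filter (f : schwartz R) : ProperFilter (nbhs f).
Proof.
apply: Build_ProperFilter_ex.
  move=> A [n [e e0 eA]]; exists f; apply: eA.
  by rewrite /= subrr schwartz_norm0 lte_fin.
split.
- by exists 0%N; exists 1.
- move=> A B [m [d d0 dA]] [n [e e0 eB]].
  exists (maxn m n), (Num.min d e); first by rewrite lt_min d0.
  move=> g /= gf; split.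
    apply: dA => /=; apply: (le_lt_trans (schwartz_norm_homo (g - f) (leq_maxl m n))).
    by apply: lt_le_trans gf _; rewrite lee_fin ge_min lexx.
  apply: eB => /=; apply: (le_lt_trans (schwartz_norm_homo (g - f) (leq_maxr m n))).
  by apply: lt_le_trans gf _; rewrite lee_fin ge_min lexx orbT.
- by move=> A B AB [n [e e0 eA]]; exists n, e => //; exact: subset_trans AB.
Qed.

Fact schwartz_nbhs_singleton (f : schwartz R) (A : set (schwartz R)) :
  nbhs f A -> A f.
Proof. by move=> [n [e e0]]; apply; rewrite /= subrr schwartz_norm0 lte_fin. Qed.

Fact schwartz_nbhs_nbhs (f : schwartz R) (A : set (schwartz R)) :
  nbhs f A -> nbhs f (nbhs^~ A).
Proof.
move=> [n [e e0 eA]]; have e20 : 0 < e / 2 by rewrite divr_gt0.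
exists n, (e / 2) => // g /= gf; exists n, (e / 2) => // h /= hg.
apply: eA; rewrite /mkset (_ : h - f = (h - g) + (g - f)); last first.
  by rewrite addrA subrK.
apply: le_lt_trans (schwartz_norm_triangle n _ _) _.
by rewrite [e]splitr EFinD; exact: lteD.
Qed.

HB.instance Definition _ := Nbhs_isNbhsTopological.Build (schwartz R)
  schwartz_nbhs_filter schwartz_nbhs_singleton schwartz_nbhs_nbhs.

End schwartz_space.

Definition comp_stable (R : realType) (phi : R -> R) : Prop :=
  forall f : schwartz R, f \o phi \in @schwartz_pred R.

Definition comp_fun (R : realType) (phi : R -> R) (h : comp_stable phi)
  (f : schwartz R) : schwartz R := Schwartz (h f).

Record symbol (R : realType) := Symbol {
  symbol_fun :> R -> R;
  symbol_smooth : smooth symbol_fun;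
  symbol_stable : comp_stable symbol_fun;
  symbol_continuous : continuous (comp_fun symbol_stable) }.

Definition comp_op (R : realType) (phi : symbol R) :
  schwartz R -> schwartz R := comp_fun (@symbol_stable R phi).

Fact comp_op_is_linear (R : realType) (phi : symbol R) : linear (comp_op phi).
Proof. by move=> l f g; apply/val_inj. Qed.

HB.instance Definition _ (R : realType) (phi : symbol R) :=
  GRing.isLinear.Build R[i] (schwartz R) (schwartz R) *:%R (comp_op phi)
    (comp_op_is_linear phi).

Definition point_spectrum (K : fieldType) (V : lmodType K)
  (T : {linear V -> V}) : set K :=
  [set l | exists2 v : V, v != 0 & T v = l *: v].

(* Main.v *)
Require Import Defs.
From mathcomp Require Import all_boot all_order all_algebra.
From mathcomp Require Import all_classical all_reals all_analysis.
From mathcomp Require Import complex.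
From mathcomp Require Import ring lra.
Set Implicit Arguments.
Unset Strict Implicit.
Unset Printing Implicit Defensive.
Import Order.TTheory GRing.Theory Num.Theory numFieldNormedType.Exports.
Local Open Scope ring_scope.
Local Open Scope classical_set_scope.

(** Let [f] be an eigenvector of [C_phi] for the eigenvalue [l]. A symbol is
    proper, because composing a compactly supported bump with it must give a
    decaying function; being increasing and continuous, [phi] is therefore a
    bijection of the line ([symbol_surjective]). So [f \o phi] and [f] have the
    same range, and comparing the suprema of their moduli gives [`|l| = 1]
    ([norm_eigenvalue]).

    The orbit of any point [x] under [phi] is monotone, so it converges to a
    fixed point [p] or leaves every compact set; since [f] tends to [0] at
    infinity, the values of [f] along the orbit converge to [f p] or to [0]
    ([orbit_limit]). At a fixed point [f p = l * f p]. If [l != 1] the limit is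
    thus [0] in both cases, while the modulus of [f] is constant along the
    orbit: [f x = 0], and there is no eigenvalue other than [1]
    ([eigenvector_eq0]).

    If [l = 1], then [f] is constant along orbits, and the orbits of all points
    between [x] and [phi x] have the same limit by squeezing; so [f] is constant
    on the segment between [x] and [phi x] ([invariant_between]). When the fixed
    points have empty interior, every open interval contains a nondegenerate
    part of such a segment, hence by Rolle's theorem a zero of the derivative of
    the real and of the imaginary part of [f]. These derivatives are continuous,
    so they vanish and [f] is a constant tending to [0] at infinity, that is [0]
    ([invariant_eq0]). This step is where the smoothness of [f] matters: for a
    Cantor-like set of fixed points, a merely continuous [f] could behave like
    the Cantor function.

    Conversely, a bump supported in an interval of fixed points is invariant
    under [phi], as an injective map that fixes an interval pointwise preserves
    its complement. The bumps are the products
    [exp (- 1 / (x - a)) * exp (- 1 / (b - x))], cut off outside [a < x < b];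
    their smoothness is obtained from families of functions stable under
    differentiation ([smooth_coind]). *)

(** * Smooth functions and compact supports *)

Lemma derivable_continuous {R : realType} {V : normedModType R} (f : R -> V) :
  (forall x, derivable f x 1) -> continuous f.
Proof. by move=> df x; apply/differentiable_continuous/derivable1_diffP. Qed.

(** Smoothness by coinduction: it avoids closed formulas for the iterated
    derivatives. *)
Lemma smooth_coind {R : realType} {V : normedModType R}
    (P : (R -> V) -> Prop) :
  (forall f, P f ->
     exists2 g, P g & forall x, is_derive x (1 : R) f (g x)) ->
  forall f, P f -> smooth f.
Proof.
move=> Pder f Pf n x.
have Pn : P (f^`(n)).
  elim: n => // n /Pder [g Pg dg]; rewrite derive1nS.
  suff -> : (f^`(n))^`() = g by [].
  by apply/funext => y; rewrite derive1E; case: (dg y).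
by have [g _ /(_ x) []] := Pder _ Pn.
Qed.

Lemma is_derive_scale_cst {R : realType} {V : normedModType R}
    (f : R -> R) (v : V) (x df : R) :
  is_derive x (1 : R) f df -> is_derive x 1 (fun y => f y *: v) (df *: v).
Proof.
move=> [dfx dfE].
suff dl : h^-1 *: (((fun y => f y *: v) \o shift x) (h *: 1) - f x *: v)
    @[h --> 0^'] --> df *: v.
  by apply: DeriveDef; [apply/cvg_ex; eexists; exact: dl|exact: cvg_lim dl].
under eq_fun do rewrite /= -scalerBl scalerA.
by apply: cvgZr_tmp; rewrite -dfE; exact: dfx.
Qed.

(** The complement of the segment is open, so the derivatives there only see
    the zero function. *)
Lemma derive1n_eq0 {R : realType} {V : normedModType R} (f : R -> V)
    (a b : R) n :
  (forall x, x \notin `[a, b]%R -> f x = 0) ->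
  forall x, x \notin `[a, b]%R -> f^`(n) x = 0.
Proof.
move=> f0; elim: n => // n IHn x xab.
rewrite derive1nS derive1E (_ : 'D_1 _ x = 'D_1 (cst 0 : R -> V) x).
  by rewrite derive_cst.
apply: near_eq_derive.
have : open (~` `[a, b]) by exact/closed_openC/itv_closed.
rewrite openE => /(_ x); rewrite /interior /= => -/(_ (negP xab)).
by apply: filterS => y /negP yab; rewrite IHn.
Qed.
(** On [`[a, b]] each weighted derivative is continuous, hence bounded;
    elsewhere it is [0]. *)
Lemma schwartz_compact_support {R : realType} (f : R -> Rcomplex R) (a b : R) :
  a <= b -> smooth f -> (forall x, x \notin `[a, b]%R -> f x = 0) ->
  is_schwartz f.
Proof.
move=> ab sf f0; split=> // n.
suff [M fM] : exists M, forall x j, (j <= n)%N ->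
    (1 + `|x| ^+ 2) ^+ n * `|f^`(j)%classic x| <= M.
  by apply: le_lt_trans (ltry M); apply/schwartz_normP.
have bound j : exists M, forall x,
    (1 + `|x| ^+ 2) ^+ n * `|f^`(j)%classic x| <= M.
  have cX k (u : R -> R) y : u t @[t --> y] --> u y ->
      u t ^+ k @[t --> y] --> u y ^+ k.
    by move=> cu; exact: (continuous_cvg _ (@exprn_continuous R k (u y)) cu).
  have cg : continuous (fun x : R =>
      (1 + `|x| ^+ 2) ^+ n * `|f^`(j)%classic x|).
    move=> x; apply: cvgM; last first.
      by apply: cvg_norm; apply: derivable_continuous; exact: sf.
    apply: (cX n); apply: cvgD; first exact: cvg_cst.
    by apply: (cX 2%N); apply: cvg_norm; exact: cvg_id.
  have [c _ cmax] := EVT_max ab (continuous_subspaceT cg).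
  eexists => x; have [/cmax //|xab] := boolP (x \in `[a, b]%R).
    exact.
  rewrite (derive1n_eq0 j f0 xab) normr0 mulr0.
  by rewrite mulr_ge0 // exprn_ge0 // addr_ge0 // exprn_ge0.
elim: {1}n => [|m [M fM]].
  by have [M fM] := bound 0%N; exists M => x j; rewrite leqn0 => /eqP ->.
have [N fN] := bound m.+1; exists (Num.max M N) => x j.
rewrite leq_eqVlt ltnS le_max => /orP[/eqP ->|jm]; first by rewrite fN orbT.
by rewrite fM.
Qed.

(** * A flat function at the origin *)

(** The functions [p (1 / x) * exp (- 1 / x)], with [p] a polynomial,
    contain [exp (- 1 / x)] and form a family stable under differentiation. *)
Definition flat {R : realType} (p : {poly R}) (x : R) : R :=
  if 0 < x then p.[x^-1] * expR (- x^-1) else 0.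

Lemma flat_le0 {R : realType} (p : {poly R}) (x : R) : x <= 0 -> flat p x = 0.
Proof. by rewrite /flat ltNge => ->. Qed.

Lemma flatN {R : realType} (p : {poly R}) (x : R) : flat (- p) x = - flat p x.
Proof. by rewrite /flat; case: ifP => _; rewrite ?oppr0 // hornerN mulNr. Qed.

(** Monomial by monomial, from [y ^+ n / n`! <= expR y]. *)
Lemma horner_le_expR {R : realType} (p : {poly R}) :
  exists C, forall y, 0 <= y -> `|p.[y]| <= C * expR y.
Proof.
exists (\sum_(i < size p) `|p`_i| * i`!%:R) => y y0.
rewrite horner_coef mulr_suml; apply: le_trans (ler_norm_sum _ _ _) _.
apply: ler_sum => i _; rewrite normrM -mulrA ler_wpM2l //.
rewrite ger0_norm ?exprn_ge0 //; case: (nat_of_ord i) => [|n].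
  by rewrite expr0 fact0 mul1r -expR0 ler_expR.
rewrite -ler_pdivrMl ?ltr0n ?fact_gt0 // mulrC.
by apply: le_trans (expR_ge1Dxn n y0); rewrite lerDr.
Qed.

(** With [y = 1 / x], this is the domination of [p (y) * y ^+ 2] by
    [expR y]. *)
Lemma flat_le_sqr {R : realType} (p : {poly R}) :
  exists C, forall x, `|flat p x| <= C * x ^+ 2.
Proof.
have [C pC] := horner_le_expR (p * 'X^2).
have C0 : 0 <= C.
  by have := pC 0 (lexx 0); rewrite expR0 mulr1; exact: le_trans.
exists C => x; rewrite /flat; case: ifPn => [x0|_]; last first.
  by rewrite normr0 mulr_ge0 // sqr_ge0.
have /pC : 0 <= x^-1 by rewrite invr_ge0 ltW.
rewrite hornerM hornerXn normrM normrX [`|x^-1|]gtr0_norm ?invr_gt0 // => pCx.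
rewrite normrM (gtr0_norm (expR_gt0 _)) expRN ler_pdivrMr ?expR_gt0 //.
by rewrite mulrAC -ler_pdivrMr ?exprn_gt0 // -exprVn.
Qed.

Lemma is_derive_le_sqr {R : realType} (f : R -> R) (C : R) :
  (forall x, `|f x| <= C * x ^+ 2) -> is_derive (0 : R) (1 : R) f 0.
Proof.
move=> fC.
have f0 : f 0 = 0.
  by apply/eqP; rewrite -normr_le0 (le_trans (fC 0)) // expr0n mulr0.
suff dl : h^-1 *: ((f \o shift 0) (h *: 1) - f 0) @[h --> 0^'] --> (0 : R).
  by apply: DeriveDef; [apply/cvg_ex; eexists; exact: dl|exact: cvg_lim dl].
rewrite f0; apply: norm_cvg0.
apply: (@squeeze_cvgr _ _ _ _ (fun=> 0) (fun h : R => C * `|h|)).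
- near=> h; rewrite normr_ge0 /= subr0 addr0.
  have h0 : h != 0 by near: h; exact: nbhs_dnbhs_neq.
  rewrite [h *: 1]mulr1 normrZ normfV mulrC ler_pdivrMr ?normr_gt0 //.
  by rewrite -mulrA -expr2 real_normK ?num_real.
- exact: cvg_cst.
- rewrite -[X in _ --> X](mulr0 C); apply: cvgM; first exact: cvg_cst.
  rewrite -[X in _ --> X](normr0 R); apply: cvg_norm; exact: cvg_within.
Unshelve. all: by end_near. Qed.

(** By the chain rule for [0 < x]; at [0] both sides vanish because
    [flat p] is quadratically small. *)
Lemma is_derive_flat {R : realType} (p : {poly R}) (x : R) :
  is_derive x 1 (flat p) (flat ('X^2 * (p - p^`())) x).
Proof.
have [x0|x0|->] := ltgtP x 0.
- rewrite (flat_le0 _ (ltW x0)); apply: (near_eq_is_derive (f := fun=> 0)).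
    near=> y; apply/esym/flat_le0/ltW; near: y; exact: lt_nbhsl.
- rewrite /flat x0.
  apply: (near_eq_is_derive (f := fun y : R => p.[y^-1] * expR (- y^-1))).
    near=> y; rewrite ifT //; near: y; exact: lt_nbhsr.
  have xn0 : x != 0 by rewrite gt_eqF.
  have dV : is_derive x (1 : R) (fun y : R => y^-1) (- x ^- 2).
    apply: is_derive_eq; first exact: (@is_deriveV R id x 1 1 xn0).
    exact: mulr1.
  have dh y : is_derive y (1 : R) (horner p) p^`().[y].
    apply: DeriveDef; first exact: derivable_horner.
    by rewrite -derive1E -derivE.
  have dp : is_derive x (1 : R) (fun y => p.[y^-1]) (p^`().[x^-1] * (- x ^- 2)).
    exact: (is_derive1_comp (dh _) dV).
  have dE : is_derive x (1 : R) (fun y => expR (- y^-1))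
      (expR (- x^-1) * (- - x ^- 2)).
    exact: (is_derive1_comp (is_derive_expR _) (is_deriveN dV)).
  have := is_deriveM dp dE; rewrite mulrfctE => dM; apply: is_derive_eq dM _.
  rewrite hornerM hornerXn hornerD hornerN -exprVn /GRing.scale /=.
  by ring.
- have [C pC] := flat_le_sqr p.
  by rewrite (flat_le0 _ (lexx 0)); exact: is_derive_le_sqr pC.
Unshelve. all: by end_near. Qed.

(** * Bump functions *)

(** The closure under derivatives of the products that define the bumps. Only
    sums and products are needed: the sign that comes from differentiating
    [b - x] is absorbed in the polynomial [q]. *)
Inductive bump_span {R : realType} (a b : R) : (R -> R) -> Prop :=
| bump_span_prod p q : bump_span a b (fun x => flat p (x - a) * flat q (b - x))
| bump_span_add f g : bump_span a b f -> bump_span a b g ->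
    bump_span a b (f \+ g).

Lemma is_derive_bump_span {R : realType} (a b : R) (f : R -> R) :
  bump_span a b f ->
  exists2 g, bump_span a b g & forall x, is_derive x (1 : R) f (g x).
Proof.
elim=> [p q|{}f g _ [f' sf df] _ [g' sg dg]]; last first.
  exists (f' \+ g'); first exact: bump_span_add.
  by move=> x; exact: is_deriveD.
set p' := 'X^2 * (p - p^`()); set q' := 'X^2 * (q - q^`()).
exists ((fun x => flat p' (x - a) * flat q (b - x)) \+
        (fun x => flat p (x - a) * flat (- q') (b - x))).
  by apply: bump_span_add; exact: bump_span_prod.
move=> x.
have da : is_derive x (1 : R) (fun y => y - a) 1.
  apply: (is_derive_eq (is_deriveB (is_derive_id _ _) (is_derive_cst _ _ _))).
  by rewrite subr0.
have db : is_derive x (1 : R) (fun y => b - y) (- 1).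
  apply: (is_derive_eq (is_deriveB (is_derive_cst _ _ _) (is_derive_id _ _))).
  by rewrite sub0r.
have dp : is_derive x (1 : R) (fun y => flat p (y - a)) (flat p' (x - a) * 1).
  exact: (is_derive1_comp (is_derive_flat p _) da).
have dq : is_derive x (1 : R) (fun y => flat q (b - y)) (flat q' (b - x) * -1).
  exact: (is_derive1_comp (is_derive_flat q _) db).
have := is_deriveM dp dq; rewrite mulrfctE => dM; apply: is_derive_eq dM _.
by rewrite /= flatN /GRing.scale /=; ring.
Qed.

Definition bump_fun {R : realType} (a b x : R) : Rcomplex R :=
  (flat 1 (x - a) * flat 1 (b - x)) *: 1.

Lemma bump_fun_eq0 {R : realType} (a b x : R) :
  x \notin `]a, b[%R -> bump_fun a b x = 0.
Proof.
rewrite in_itv /= negb_and -!leNgt /bump_fun => /orP[xa|bx].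
  by rewrite (@flat_le0 R 1 (x - a)) ?subr_le0 // mul0r scale0r.
by rewrite (@flat_le0 R 1 (b - x)) ?subr_le0 // mulr0 scale0r.
Qed.

Lemma bump_fun_neq0 {R : realType} (a b x : R) :
  x \in `]a, b[%R -> bump_fun a b x != 0.
Proof.
rewrite in_itv /= => /andP[ax xb].
rewrite /bump_fun scaler_eq0 oner_eq0 orbF gt_eqF // /flat !subr_gt0 ax xb.
by rewrite !hornerC !mul1r mulr_gt0 // expR_gt0.
Qed.

Lemma is_schwartz_bump_fun {R : realType} (a b : R) :
  a <= b -> is_schwartz (bump_fun a b).
Proof.
move=> ab; apply: (schwartz_compact_support ab); last first.
  move=> x xab; apply: bump_fun_eq0; apply: contra xab.
  exact: subset_itv_oo_cc.
apply: (smooth_coind (P := fun f => exists2 u, bump_span a b u &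
  f = fun x => u x *: (1 : Rcomplex R))); last first.
  by eexists; [exact: (bump_span_prod a b 1 1)|].
move=> _ [u su ->]; have [v sv dv] := is_derive_bump_span su.
exists (fun x => v x *: (1 : Rcomplex R)); first by exists v.
by move=> x; exact: is_derive_scale_cst (dv x).
Qed.

Lemma bump_fun_in_schwartz {R : realType} (a b : R) :
  a <= b -> bump_fun a b \in @schwartz_pred R.
Proof. by move=> ab; rewrite inE; exact: is_schwartz_bump_fun. Qed.

Definition bump {R : realType} (a b : R) (ab : a <= b) : schwartz R :=
  Schwartz (bump_fun_in_schwartz ab).

(** * Symbols are proper, and eigenvalues have modulus one *)

Lemma schwartz_decay {R : realType} (f : schwartz R) :
  exists M, forall x, (1 + `|x| ^+ 2) * `|f x : Rcomplex R| <= M.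
Proof.
have [_ /(_ 1%N) /schwartz_norm_fin [M fM]] := schwartz_is_schwartz f.
exists M => x; have [+ _] := schwartz_normP 1 f M.
by rewrite fM lexx => /(_ isT x 0%N (leq0n _)).
Qed.

Lemma schwartz_bounded {R : realType} (f : schwartz R) :
  exists M, forall x, `|f x : Rcomplex R| <= M.
Proof.
have [M fM] := schwartz_decay f; exists M => x; apply: le_trans (fM x).
by rewrite ler_peMl // lerDl exprn_ge0.
Qed.

Definition vanishes_at_infinity {R : realType} {V : normedModType R}
    (f : R -> V) : Prop :=
  forall e : R, 0 < e -> exists T, forall x, T <= `|x| -> `|f x| < e.

(** The weight [1 + `|x| ^+ 2] dominates [`|x|]. *)
Lemma schwartz_vanishing {R : realType} (f : schwartz R) :
  vanishes_at_infinity (f : R -> Rcomplex R).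
Proof.
move=> e e0; have [M fM] := schwartz_decay f; exists (M / e) => x.
rewrite ler_pdivrMr // => Mx; rewrite ltNge; apply/negP => ex.
have : (1 + `|x| ^+ 2) * e <= `|x| * e.
  apply: le_trans Mx; apply: le_trans (fM x).
  by rewrite ler_wpM2l // addr_ge0 // exprn_ge0.
by rewrite ler_pM2r //; nra.
Qed.

Lemma schwartz_derivable {R : realType} (f : schwartz R) (n : nat) (x : R) :
  derivable (derive1n n (f : R -> Rcomplex R)) x 1.
Proof. by have [sf _] := schwartz_is_schwartz f; exact: sf. Qed.

Lemma schwartz_continuous {R : realType} (f : schwartz R) :
  continuous (f : R -> Rcomplex R).
Proof. by apply: derivable_continuous; exact: (@schwartz_derivable R f 0). Qed.

(** A bump [f] that is positive on [`[a, b]] is bounded below there by some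
    [m > 0], whereas [f \o phi] is eventually smaller than [m]. *)
Lemma symbol_proper {R : realType} (phi : symbol R) (a b : R) : a <= b ->
  exists T, forall x, T <= `|x| -> phi x \notin `[a, b]%R.
Proof.
move=> ab; have ab1 : a - 1 <= b + 1 by lra.
pose f := bump ab1.
have cf : continuous (fun x => `|f x : Rcomplex R|).
  by move=> x; apply: cvg_norm; exact: schwartz_continuous.
have [c cab cmin] := EVT_min ab (continuous_subspaceT cf).
have c0 : 0 < `|f c : Rcomplex R|.
  rewrite normr_gt0; apply: bump_fun_neq0; move: cab.
  by rewrite !in_itv /= => /andP[? ?]; apply/andP; split; lra.
have [T fT] := schwartz_vanishing (comp_op phi f) c0.
exists T => x /fT; rewrite ltNge; apply: contra; exact: cmin.
Qed.

Lemma continuous_symbol {R : realType} (phi : symbol R) : continuous phi.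
Proof. apply: derivable_continuous; exact: (@symbol_smooth R phi 0). Qed.

(** Far out on each side, [phi] has left any given segment around [phi 0],
    and monotonicity tells on which side of it; the intermediate value theorem
    concludes. *)
Lemma symbol_surjective {R : realType} (phi : symbol R) :
  {homo phi : x y / x < y} -> forall y, exists x, phi x = y.
Proof.
move=> phi_incr y; have phi_le := ltW_homo phi_incr.
pose a := Num.min (phi 0) y; pose b := Num.max (phi 0) y.
have ab : a <= b by rewrite /a /b ge_min le_max lexx.
have [T phiT] := symbol_proper phi ab.
pose S := Num.max T 0; have S0 : 0 <= S by rewrite le_max lexx orbT.
have TS : T <= S by rewrite le_max lexx.
have a0 : a <= phi 0 <= b by rewrite ge_min le_max lexx.
have ay : a <= y <= b by rewrite ge_min le_max lexx !orbT.
have Sr : b < phi S.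
  have := phiT S; rewrite ger0_norm // => /(_ TS).
  rewrite in_itv /= negb_and -!ltNge => /orP[|//].
  by have := phi_le _ _ S0; lra.
have Sl : phi (- S) < a.
  have := phiT (- S); rewrite normrN ger0_norm // => /(_ TS).
  rewrite in_itv /= negb_and -!ltNge => /orP[//|].
  by have := phi_le (- S) 0; rewrite oppr_le0 => /(_ S0); lra.
have SS : - S <= S by lra.
have [|c _ <-] := @IVT R phi (- S) S y SS
  (continuous_subspaceT (@continuous_symbol R phi)); last by exists c.
by rewrite ge_min le_max; apply/andP; split; apply/orP; [left|right]; lra.
Qed.

(** The numbers [`|F x|] and [`|F (g x)| = `|l| * `|F x|] have the same range,
    so their supremum [S > 0] satisfies [S = `|l| * S]. *)
Lemma norm_eigenvalue {R : realType} (g : R -> R) (F : R -> Rcomplex R)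
    (l : Rcomplex R) (M x0 : R) :
  (forall y, exists x, g x = y) -> (forall x, `|F x| <= M) ->
  (forall x, F (g x) = l * F x) -> F x0 != 0 -> `|l| = 1.
Proof.
move=> gsurj FM Fg Fx0; pose S := sup (range (fun x => `|F x|)).
have FS x : `|F x| <= S.
  by apply: ub_le_sup; [exists M => _ [y _ <-]|exists x].
have SF c : (forall x, `|F x| <= c) -> S <= c.
  by move=> Fc; apply: sup_le_ub; [exists `|F x0|; exists x0|move=> _ [y _ <-]].
have S0 : 0 < S by apply: lt_le_trans (FS x0); rewrite normr_gt0.
have l1 : 1 <= `|l|.
  rewrite -(ler_pM2r S0) mul1r; apply: SF => y; have [x <-] := gsurj y.
  by rewrite Fg Rcomplex_normM ler_wpM2l.
apply/eqP; rewrite eq_le l1 andbT.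
have l0 : 0 < `|l| by exact: lt_le_trans l1.
rewrite -(ler_pM2r S0) mul1r mulrC -ler_pdivlMr //; apply: SF => x.
by rewrite ler_pdivlMr // mulrC -Rcomplex_normM -Fg.
Qed.

(** * Limits along orbits *)

(** Whether [g] moves a point to the right or to the left is not known in
    advance, so segments are unoriented. *)
Definition between {R : realType} (x y z : R) : bool :=
  (x <= y <= z) || (z <= y <= x).

(** The orbit of [x] is nondecreasing, so it converges to a fixed point or
    tends to infinity. The orbit of [y] is squeezed between that of [x] and
    its shift, hence the common limit [l]. *)
Lemma orbit_limit_ge {R : realType} {V : normedModType R} (g : R -> R)
    (F : R -> V) (x : R) :
  continuous g -> {homo g : x y / x <= y} -> continuous F ->
  vanishes_at_infinity F ->
  x <= g x ->
  exists2 l, l = 0 \/ (exists2 p, g p = p & F p = l) &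
    forall y, x <= y <= g x -> F (iter n g y) @[n --> \oo] --> l.
Proof.
move=> cg ghomo cF F0 xgx; pose u n := iter n g x.
have u_incr : nondecreasing_seq u.
  by apply/nondecreasing_seqP; elim=> [//|n IHn]; exact: ghomo.
have u_le y n : x <= y <= g x -> u n <= iter n g y <= u n.+1.
  move=> xyg; elim: n => [//|n /andP[IHl IHr]].
  by apply/andP; split; exact: ghomo.
have [cu|du] := pselect (cvgn u); last first.
  exists 0; first by left.
  move=> y xyg; apply/cvgr0Pnorm_lt => e e0; have [T FT] := F0 e e0.
  have /cvgryPge /(_ T) := nondecreasing_dvgn_lt u_incr du.
  apply: filterS => n Tu; apply: FT; apply: le_trans (ler_norm _).
  by have /andP[uy _] := u_le y n xyg; exact: le_trans uy.
have uS : u n.+1 @[n --> \oo] --> limn u by rewrite cvg_shiftS.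
exists (F (limn u)).
  right; exists (limn u) => //.
  have gu : g (u n) @[n --> \oo] --> g (limn u).
    exact: (continuous_cvg _ (cg (limn u)) cu).
  by apply: (cvg_unique _ gu uS).
move=> y xyg.
suff uy : iter n g y @[n --> \oo] --> limn u.
  exact: (continuous_cvg _ (cF _) uy).
apply: (squeeze_cvgr _ cu uS); near=> n; exact: u_le.
Unshelve. all: by end_near. Qed.

(** The case [g x <= x] reduces to [orbit_limit_ge] by reflecting the line:
    [y |-> - g (- y)] moves [- x] to the right. *)
Lemma orbit_limit {R : realType} {V : normedModType R} (g : R -> R)
    (F : R -> V) (x : R) :
  continuous g -> {homo g : x y / x <= y} -> continuous F ->
  vanishes_at_infinity F ->
  exists2 l, l = 0 \/ (exists2 p, g p = p & F p = l) &
    forall y, between x y (g x) -> F (iter n g y) @[n --> \oo] --> l.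
Proof.
move=> cg ghomo cF F0; have [xgx|/ltW gxx] := leP x (g x).
  have [l lE Fl] := orbit_limit_ge cg ghomo cF F0 xgx.
  exists l => // y /orP[/Fl //|/andP[gxy yx]].
  by apply: Fl; rewrite (le_trans xgx gxy) (le_trans yx xgx).
pose h y := - g (- y); pose G y := F (- y).
have ch : continuous h.
  move=> y; apply: cvgN.
  exact: (continuous_cvg _ (cg _) (@oppr_continuous _ _ y)).
have cG : continuous G.
  by move=> y; exact: (continuous_cvg _ (cF _) (@oppr_continuous _ _ y)).
have hhomo : {homo h : y z / y <= z}.
  by move=> y z yz; rewrite lerN2; apply: ghomo; rewrite lerN2.
have G0 : vanishes_at_infinity G.
  move=> e /F0 [T FT]; exists T => y Ty; apply: FT; by rewrite normrN.
have hx : - x <= h (- x) by rewrite /h opprK lerN2.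
have hiter n y : - iter n h (- y) = iter n g y.
  elim: n => [|n IHn]; first by rewrite opprK.
  by rewrite !iterS -IHn [LHS]opprK.
have [l lE Gl] := orbit_limit_ge ch hhomo cG G0 hx; exists l.
  case: lE => [->|[p hp Gp]]; [by left|right].
  by exists (- p); rewrite // -{2}hp /h opprK.
move=> y xy; have {}xy : g x <= y <= x.
  case/orP: xy => // /andP[xy ygx].
  by rewrite (le_trans gxx xy) (le_trans ygx gxx).
under eq_fun do rewrite -hiter.
by apply: Gl; rewrite /h opprK !lerN2 andbC.
Qed.

Lemma eigenvector_eq0 {R : realType} (g : R -> R) (F : R -> Rcomplex R)
    (l : Rcomplex R) :
  continuous g -> {homo g : x y / x <= y} -> continuous F ->
  vanishes_at_infinity F ->
  (forall x, F (g x) = l * F x) -> `|l| = 1 -> l != 1 -> forall x, F x = 0.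
Proof.
move=> cg ghomo cF F0 Fg l1 ln1 x.
have [m mE /(_ x)] := orbit_limit x cg ghomo cF F0.
have {mE} -> : m = 0.
  case: mE => // -[p gp <-]; have := Fg p; rewrite gp => /eqP.
  rewrite -{1}[F p]mul1r -subr_eq0 -mulrBl mulf_eq0 subr_eq0 eq_sym.
  by rewrite (negbTE ln1) => /eqP.
rewrite /between lexx /= andbT le_total => /(_ isT) Fl0.
have Fx n : `|F (iter n g x)| = `|F x|.
  by elim: n => //= n <-; rewrite Fg Rcomplex_normM l1 mul1r.
apply/eqP; rewrite -normr_eq0; apply/eqP.
have F0x : `|F (iter n g x)| @[n --> \oo] --> `|0 : Rcomplex R|.
  exact: cvg_norm.
move: F0x; rewrite normr0; under eq_fun do rewrite Fx.
by move=> F0x; apply: (cvg_unique _ (cvg_cst `|F x|) F0x).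
Qed.

Lemma invariant_between {R : realType} {V : normedModType R} (g : R -> R)
    (F : R -> V) (x y : R) :
  continuous g -> {homo g : x y / x <= y} -> continuous F ->
  vanishes_at_infinity F ->
  (forall x, F (g x) = F x) -> between x y (g x) -> F y = F x.
Proof.
move=> cg ghomo cF F0 Fg xy.
have [l _ Fl] := orbit_limit x cg ghomo cF F0.
have Flim z : between x z (g x) -> F z = l.
  have Fz n : F (iter n g z) = F z by elim: n => //= n <-.
  move=> /Fl; under eq_fun do rewrite Fz.
  by move=> Fzl; apply: (cvg_unique _ (cvg_cst (F z)) Fzl).
by rewrite (Flim y xy) Flim // /between lexx /= andbT le_total.
Qed.

(** * Invariant functions when the fixed points have empty interior *)

(** If the derivative did not vanish at [x], by continuity it would have no
    zero in a whole ball around [x]. This ball contains a point [t] that [g]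
    moves, and [u] takes the same value at [t] and at a nearby point [s]
    between [t] and [g t]: Rolle's theorem yields a zero in the ball. *)
Lemma derive1_eq0_of_between {R : realType} (g u : R -> R) :
  (forall x, derivable u x 1) -> continuous u^`()%classic ->
  (forall x y, between x y (g x) -> u y = u x) ->
  [set t | g t = t]° = set0 -> forall x, u^`()%classic x = 0.
Proof.
move=> du cu' gu fix0 x; apply/eqP/negP => /negP u'x.
have cu : continuous u by exact: derivable_continuous.
have rolle a b : a < b -> u a = u b ->
    exists2 c, a < c < b & u^`()%classic c = 0.
  move=> ab uab.
  have [c] := Rolle ab (fun y _ => du y) (continuous_subspaceT cu) uab.
  by rewrite in_itv /= => acb [_ uc]; exists c => //; rewrite derive1E.
have [e /= e0 u'e] : nbhs x [set y | u^`()%classic y != 0].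
  exact: (cvgr_neq0 _ (cu' x) u'x).
have [t xt gt] : exists2 t, ball x e t & g t != t.
  apply: contrapT => nt; suff : [set t | g t = t]° x by rewrite fix0.
  exists e => //= t xt; apply: contrapT => /eqP gt; apply: nt; by exists t.
move: xt; rewrite /ball /= ltr_distlC => /andP[xt tx].
have zero a b : x - e < a -> a < b -> b < x + e -> u a <> u b.
  move=> ea ab be /(rolle _ _ ab)[c /andP[ac cb]]; apply/eqP; apply: u'e.
  by rewrite /= ltr_distlC; apply/andP; split; lra.
have [gtt|tgt|/eqP] := ltgtP (g t) t; last by rewrite (negbTE gt).
  (* The midpoint keeps [s] inside the ball when [g t] is outside. *)
  pose s := Num.max (g t) ((x - e + t) / 2).
  have st : s < t by rewrite gt_max gtt /=; lra.
  have gs : g t <= s by rewrite le_max lexx.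
  have es : x - e < s by rewrite lt_max; apply/orP; right; lra.
  by apply: (zero s t) => //; apply: gu; rewrite /between gs (ltW st) orbT.
pose s := Num.min (g t) ((x + e + t) / 2).
have ts : t < s by rewrite lt_min tgt /=; lra.
have sg : s <= g t by rewrite ge_min lexx.
have se : s < x + e by rewrite gt_min; apply/orP; right; lra.
by apply: (zero t s) => //; apply/esym/gu; rewrite /between sg (ltW ts).
Qed.

(** The real and imaginary parts are the contractions in view: they bring the
    complex-valued problem back to real functions, for which Rolle's theorem
    and the mean value theorem hold. *)
Lemma cvg_contraction {R : realType} {V W : normedModType R}
    (L : {linear V -> W}) {T : Type} (F : set_system T) {FF : Filter F}
    (f : T -> V) (l : V) :
  (forall v, `|L v| <= `|v|) -> f @ F --> l -> (L \o f) @ F --> L l.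
Proof.
move=> L1 /cvgrPdist_lt fl; apply/cvgrPdist_lt => e /fl.
by apply: filterS => t; apply: le_lt_trans; rewrite /= -raddfB; exact: L1.
Qed.

Lemma is_derive_contraction {R : realType} {V W : normedModType R}
    (L : {linear V -> W}) (f : R -> V) (x : R) (d : V) :
  (forall v, `|L v| <= `|v|) ->
  is_derive x (1 : R) f d -> is_derive x 1 (L \o f) (L d).
Proof.
move=> L1 [dfx <-].
suff dl : h^-1 *: (((L \o f) \o shift x) (h *: 1) - (L \o f) x)
    @[h --> 0^'] --> L ('D_1 f x).
  by apply: DeriveDef; [apply/cvg_ex; eexists; exact: dl|exact: cvg_lim dl].
rewrite (_ : (fun h => _) =
    L \o (fun h => h^-1 *: ((f \o shift x) (h *: 1) - f x))).
  exact: (cvg_contraction L1 dfx).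
by apply/funext => h; rewrite [RHS]/= linearZ (raddfB L).
Qed.

Lemma contraction_const {R : realType} {V : normedModType R}
    (L : {linear V -> R}) (g : R -> R) (f : R -> V) :
  (forall v, `|L v| <= `|v|) ->
  (forall x, derivable f x 1) -> continuous f^`()%classic ->
  (forall x y, between x y (g x) -> f y = f x) ->
  [set t | g t = t]° = set0 -> forall x y, L (f x) = L (f y).
Proof.
move=> L1 df cf' gf fix0 x y; pose u := L \o f.
have du z : is_derive z (1 : R) u (L (f^`()%classic z)).
  by apply: is_derive_contraction => //; rewrite derive1E; exact: derivableP.
have u'E : u^`()%classic = L \o f^`()%classic.
  by apply/funext => z; rewrite derive1E; case: (du z).
have u'0 : forall z, u^`()%classic z = 0.
  apply: (@derive1_eq0_of_between R g) => //.
  - rewrite u'E => z; exact: cvg_contraction L1 (cf' z).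
  - by move=> a b /gf; rewrite /u /= => ->.
by apply: (is_derive_0_is_cst (f := u)) => z; rewrite -(u'0 z) u'E; exact: du.
Qed.

Lemma normr_Re {R : realType} (z : Rcomplex R) : `|complex.Re z| <= `|z|.
Proof.
case: z => a b; rewrite /= -sqrtr_sqr [leRHS]/Num.norm /=.
by rewrite ler_wsqrtr // lerDl sqr_ge0.
Qed.

Lemma normr_Im {R : realType} (z : Rcomplex R) : `|complex.Im z| <= `|z|.
Proof.
case: z => a b; rewrite /= -sqrtr_sqr [leRHS]/Num.norm /=.
by rewrite ler_wsqrtr // lerDr sqr_ge0.
Qed.

Lemma invariant_eq0 {R : realType} (phi : symbol R) (f : schwartz R) :
  {homo phi : x y / x < y} -> [set t : R | phi t = t]° = set0 ->
  (forall x, f (phi x) = f x) -> forall x, f x = 0.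
Proof.
move=> phi_incr fix0 fphi x; pose F := f : R -> Rcomplex R.
have F0 : vanishes_at_infinity F := schwartz_vanishing f.
have dF : forall y, derivable F y 1 := @schwartz_derivable R f 0.
have cF' : continuous F^`()%classic.
  apply: derivable_continuous; exact: (@schwartz_derivable R f 1).
have gF y z : between y z (phi y) -> F z = F y.
  apply: invariant_between => //; first exact: continuous_symbol.
  - exact: ltW_homo.
  - exact: schwartz_continuous.
have Fcst y : F x = F y.
  apply/eqP; rewrite eq_complex; apply/andP; split; apply/eqP.
    exact: (contraction_const (L := @complex.Re R) (@normr_Re R)
      dF cF' gF fix0).
  exact: (contraction_const (L := @complex.Im R) (@normr_Im R)
    dF cF' gF fix0).
apply/eqP; rewrite -[_ == _]/(F x == 0) -normr_eq0 eq_le normr_ge0 andbT.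
apply/ler_addgt0Pr => e /F0[T FT]; rewrite add0r (Fcst T).
by rewrite ltW // FT // ler_norm.
Qed.

(** * The point spectrum *)

Theorem proposition6 (R : realType) (phi : symbol R)
    (phi_incr : {homo phi : x y / x < y}) :
  point_spectrum (comp_op phi) `<=` [set 1] /\
  (point_spectrum (comp_op phi) = [set 1] <->
   [set t : R | phi t = t]° !=set0).
Proof.
have phi_le := ltW_homo phi_incr.
have eigenE (f : schwartz R) (l : R[i]) :
    comp_op phi f = l *: f -> forall x, f (phi x) = l * f x.
  by move=> fl x; rewrite -[LHS]/(comp_op phi f x) fl.
have nz (f : schwartz R) : f != 0 -> exists x, f x != 0.
  move=> f0; apply: contrapT => nf; move/eqP: f0; apply; apply/val_inj.
  apply/funext => x; apply: contrapT => /eqP fx; apply: nf; by exists x.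
have sub1 : point_spectrum (comp_op phi) `<=` [set 1].
  move=> l [f /nz[x0 fx0] /eigenE fl]; apply: contrapT => /eqP l1.
  have [M fM] := schwartz_bounded f.
  have l_norm : `|l : Rcomplex R| = 1.
    exact: (norm_eigenvalue (symbol_surjective phi_incr) fM fl fx0).
  move/eqP: fx0; apply; apply: (eigenvector_eq0 _ phi_le _ _ fl l_norm l1).
  - exact: continuous_symbol.
  - exact: schwartz_continuous.
  - exact: schwartz_vanishing.
split=> //; split=> [spec1|[t [e /= e0 efix]]].
  apply/set0P/negP => /eqP fix0.
  have [f /nz[x]] : point_spectrum (comp_op phi) 1 by rewrite spec1.
  move=> /eqP fx /eigenE f1; apply: fx; apply: (invariant_eq0 phi_incr fix0).
  by move=> y; rewrite f1 mul1r.
rewrite eqEsubset; split=> // _ ->.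
have te : t - e <= t + e by lra.
have in_ball y : y \in `]t - e, t + e[%R -> phi y = y.
  by rewrite in_itv /= => ty; apply: efix; rewrite /ball /= ltr_distlC.
exists (bump te).
  apply/eqP => b0; have : bump_fun (t - e) (t + e) t != 0.
    by apply: bump_fun_neq0; rewrite in_itv /=; apply/andP; split; lra.
  by rewrite -[bump_fun _ _ _]/(bump te t) b0 eqxx.
rewrite scale1r; apply/val_inj/funext => y /=.
have [/in_ball -> //|yt] := boolP (y \in `]t - e, t + e[%R).
rewrite [RHS]bump_fun_eq0 // bump_fun_eq0 //; apply: contra yt => yt.
by rewrite -(inc_inj (le_mono phi_incr) (in_ball _ yt)).
Qed.
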